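(* Let $X$ and $Y$ be complex Hilbert spaces, let $N\in\mathbb{N}$, $\alpha>0$, let $R:Y\to Y$ be a bounded, self-adjoint, positive definite, invertible linear operator (with bounded inverse), let $f_1,\dots,f_N\in Y$ be measurements, let $A_1,\dots,A_N:X\to Y$ be compact linear operators, and let $\varphi_0\in X$ be an initial guess. Let $\varphi^{KF}_N$ be the final state of the Kalman filter recursion $$\varphi^{KF}_{n}:= \varphi^{KF}_{n-1} + K_{n}\left( f_{n}-A_{n} \varphi^{KF}_{n-1} \right),\quad K_{n}:= B_{n-1} A^{H}_{n}\left(R + A_{n} B_{n-1} A^{H}_{n} \right)^{-1},\quad B_{n}:= \left(I - K_{n} A_{n} \right)B_{n-1},$$ for $n=1,\dots,N$, started from $\varphi^{KF}_0:=\varphi_0$ and $B_0:=\frac{1}{\alpha}I$. Let $\varphi^{FT}_N$ be the Full data Tikhonov solution $$\varphi^{FT}_{N} := \varphi_0 + \left( \alpha I + \vec{A}^{H} R^{-1}\vec{A} \right)^{-1}\vec{A}^{H} R^{-1}\left(\vec{f} - \vec{A}\varphi_0 \right).$$ Then $$\varphi^{KF}_{N}=\varphi^{FT}_{N}.$$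
   Context: $I$ denotes the identity operator on $X$. For each $n$, $A_n^H:Y\to X$ is the adjoint of $A_n$ with respect to the usual (unweighted) scalar products $\langle\cdot,\cdot\rangle_X$ and $\langle\cdot,\cdot\rangle_Y$. The vector $\vec{f}:=(f_1,\dots,f_N)^T\in Y^N$ and the operator $\vec{A}:X\to Y^N$, $\vec{A}\varphi:=(A_1\varphi,\dots,A_N\varphi)^T$, are obtained by stacking the measurements and operators. $Y^N$ carries the usual product scalar product, $\vec{A}^H:Y^N\to X$ is the adjoint of $\vec{A}$ with respect to the usual scalar products on $X$ and $Y^N$, and $R^{-1}$ acts on $Y^N$ componentwise; thus $\vec{A}^H R^{-1}\vec{A}=\sum_{n=1}^N A_n^H R^{-1}A_n$ and $\vec{A}^H R^{-1}\vec{f}=\sum_{n=1}^N A_n^H R^{-1} f_n$. *)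

(* Defs.v *)
From HB Require Import structures.
From mathcomp Require Import all_boot all_order all_algebra.
From mathcomp Require Import all_classical all_reals all_analysis.
From mathcomp Require Export complex.

Set Implicit Arguments.
Unset Strict Implicit.
Unset Printing Implicit Defensive.

Import Order.TTheory GRing.Theory Num.Theory.
Import numFieldNormedType.Exports.

Local Open Scope classical_set_scope.
Local Open Scope ring_scope.
Local Open Scope complex_scope.

(* Operators produced by the recursion (adjoints, inverses, gains) are plain
   functions; [R], [A n] are [{linear _ -> _}].  Both [adjoint] and [opinv] are
   total, with junk values where the adjoint (resp. inverse) does not exist. *)

(* A complex Hilbert space is a complete normed space over K[i] whose norm is
   induced by a scalar product, linear in its first argument. *)
Definition induces_norm (K : realType) (X : completeNormedModType K[i])
    (ip : {dot X for Num.conj}) : Prop :=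
  forall x : X, `|x| ^+ 2 = ip x x.

Definition bounded_op (K : realType) (X Y : normedModType K[i])
    (T : X -> Y) : Prop :=
  bounded_near T (nbhs (0 : X)).

Definition self_adjoint (C : Type) (X : Type) (ip : X -> X -> C)
    (T : X -> X) : Prop :=
  forall x y, ip (T x) y = ip x (T y).

Definition positive_definite (K : realType) (X : lmodType K[i])
    (ip : X -> X -> K[i]) (T : X -> X) : Prop :=
  forall x, x != 0 -> 0 < ip (T x) x.

Definition compact_op (K : realType) (X Y : normedModType K[i])
    (T : X -> Y) : Prop :=
  forall B : set X, bounded_set B -> precompact (T @` B).

Definition adjoint (K : realType) (X Y : lmodType K[i])
    (ipX : X -> X -> K[i]) (ipY : Y -> Y -> K[i]) (T : X -> Y) : Y -> X :=
  fun y => xget 0 [set z | forall x, ipY (T x) y = ipX x z].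

Definition opinv (K : realType) (X Y : lmodType K[i]) (T : X -> Y) : Y -> X :=
  'pinv_(fun=> 0) [set: X] T.

Section stacking.
Variables (K : realType) (X Y : lmodType K[i]) (N : nat).

(* Families are indexed by 1, ..., N, hence the shift from ['I_N]. *)
Definition stack (f : nat -> Y) : {ffun 'I_N -> Y} := [ffun i : 'I_N => f i.+1].

Definition stack_op (A : nat -> X -> Y) (x : X) : {ffun 'I_N -> Y} :=
  stack (fun n => A n x).

Definition prod_ip (ip : Y -> Y -> K[i]) (f g : {ffun 'I_N -> Y}) : K[i] :=
  \sum_(i < N) ip (f i) (g i).

Definition componentwise (T : Y -> Y) (f : {ffun 'I_N -> Y}) :
    {ffun 'I_N -> Y} :=
  [ffun i => T (f i)].

End stacking.

Section methods.
Variables (K : realType) (X Y : lmodType K[i]).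
Variables (ipX : X -> X -> K[i]) (ipY : Y -> Y -> K[i]).
Variables (alpha : K) (R : Y -> Y) (A : nat -> X -> Y) (f : nat -> Y).
Variable phi0 : X.

Let AH (n : nat) : Y -> X := adjoint ipX ipY (A n).

Definition kalman_gain (n : nat) (B : X -> X) : Y -> X :=
  B \o AH n \o opinv (R \+ (A n \o B \o AH n)).

(* [kalman n] is the pair of the n-th state and of the operator B_n. *)
Fixpoint kalman (n : nat) : X * (X -> X) :=
  match n with
  | 0 => (phi0, fun x => (alpha%:C)^-1 *: x)
  | m.+1 =>
      let: (phi, B) := kalman m in
      let G := kalman_gain m.+1 B in
      (phi + G (f m.+1 - A m.+1 phi), (id \- (G \o A m.+1)) \o B)
  end.

Definition kalman_state (n : nat) : X := (kalman n).1.

Definition full_tikhonov (N : nat) : X :=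
  let vA : X -> {ffun 'I_N -> Y} := stack_op N A in
  let vAH := adjoint ipX (prod_ip (N := N) ipY) vA in
  let Rinv := componentwise (N := N) (opinv R) in
  phi0 + opinv (fun x => alpha%:C *: x + vAH (Rinv (vA x)))
               (vAH (Rinv (stack N f - vA phi0))).

End methods.

(* Main.v *)
(* By Woodbury's identity the Kalman covariances satisfy B_n = M_n^-1, where
   M_n = alpha I + sum_(k <= n) A_k^H R^-1 A_k, and the gain is
   K_n = M_n^-1 A_n^H R^-1.  Hence M_n (phi_n - phi_0) is the sum over
   k <= n of A_k^H R^-1 (f_k - A_k phi_0), which for n = N is the normal
   equation of the full data Tikhonov problem.  Existence of the adjoints
   and bijectivity of M_n both come from minimizing a coercive quadratic
   functional on a Hilbert space. *)
Require Import Defs.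
From HB Require Import structures.
From mathcomp Require Import all_boot all_order all_algebra.
From mathcomp Require Import all_classical all_reals all_analysis.
From mathcomp Require Import ring lra.

Set Implicit Arguments.
Unset Strict Implicit.
Unset Printing Implicit Defensive.

Import Order.TTheory GRing.Theory Num.Theory.
Import numFieldNormedType.Exports.
Local Open Scope classical_set_scope.
Local Open Scope ring_scope.
Local Open Scope complex_scope.

(** * Discriminants and the real part of a scalar product *)

Lemma quad_ge0_disc (K : realFieldType) (a b c : K) : 0 <= c ->
  (forall t, 0 <= a + 2 * t * b + t ^+ 2 * c) -> b ^+ 2 <= a * c.
Proof.
rewrite le_eqVlt => /predU1P[<-|c0] h.
  rewrite mulr0; have [->|b0] := eqVneq b 0; first by rewrite expr0n.
  (* For [c = 0] the polynomial is affine; this [t] gives it the value [-1]. *)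
  have := h (- (a + 1) / (2 * b)); rewrite mulr0 addr0.
  have -> : a + 2 * (- (a + 1) / (2 * b)) * b = - 1 by field.
  by rewrite ler0N1.
have := h (- b / c).
have -> : a + 2 * (- b / c) * b + (- b / c) ^+ 2 * c = (a * c - b ^+ 2) / c.
  by field; rewrite gt_eqF.
by rewrite pmulr_lge0 ?invr_gt0// subr_ge0.
Qed.

Lemma Re_conj (K : realType) (z : K[i]) :
  complex.Re (Num.conj z) = complex.Re z.
Proof. by case: z. Qed.

Section real_part.
Variables (K : realType) (V : lmodType K[i]) (ip : {dot V for Num.conj}).

Lemma dotC x y : ip x y = Num.conj (ip y x).
Proof. by rewrite hermC expr0 mul1r. Qed.

Lemma dot_suml n (F : 'I_n -> V) y : ip (\sum_i F i) y = \sum_i ip (F i) y.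
Proof. exact: linear_sumlz. Qed.

Lemma dot_sumr n (F : 'I_n -> V) y : ip y (\sum_i F i) = \sum_i ip y (F i).
Proof. exact: linear_sumr. Qed.

Lemma dotBr x y z : ip z (x - y) = ip z x - ip z y.
Proof. exact: linearBr. Qed.

Lemma dot_realZ (t : K) x y : ip (t%:C *: x) y = ip x (t%:C *: y).
Proof. by rewrite linearZl_LR linearZr_LR/= [Num.conj _]conjc_real. Qed.

(** Makes [V] a real inner product space, where energies can be minimized; complex identities are
    recovered by testing with [v] and ['i *: v]. *)
Definition rip (x y : V) : K := complex.Re (ip x y).

Lemma ripC x y : rip x y = rip y x.
Proof. by rewrite /rip dotC Re_conj. Qed.

Lemma ripDl x y z : rip (x + y) z = rip x z + rip y z.
Proof. by rewrite /rip linearDl raddfD. Qed.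

Lemma ripZl (t : K) x y : rip (t%:C *: x) y = t * rip x y.
Proof.
by rewrite /rip linearZl_LR /=; case: (ip x y) => a b /=; rewrite mul0r subr0.
Qed.

Lemma ripBl x y z : rip (x - y) z = rip x z - rip y z.
Proof. by rewrite /rip linearBl raddfB. Qed.

Lemma ripDr x y z : rip z (x + y) = rip z x + rip z y.
Proof. by rewrite !(ripC z) ripDl. Qed.

Lemma ripBr x y z : rip z (x - y) = rip z x - rip z y.
Proof. by rewrite !(ripC z) ripBl. Qed.

Lemma ripZr (t : K) x y : rip y (t%:C *: x) = t * rip y x.
Proof. by rewrite !(ripC y) ripZl. Qed.

Lemma rip_ge0 x : 0 <= rip x x.
Proof. by have := dnorm_ge0 ip x; rewrite lecE => /andP[]. Qed.

Lemma rip0l x : rip 0 x = 0.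
Proof. by rewrite /rip linear0l. Qed.

Lemma rip_CS x y : rip x y ^+ 2 <= rip x x * rip y y.
Proof.
apply: quad_ge0_disc => [|t]; first exact: rip_ge0.
have -> : rip x x + 2 * t * rip x y + t ^+ 2 * rip y y
    = rip (x + t%:C *: y) (x + t%:C *: y).
  by rewrite ripDl !ripDr !ripZl !ripZr (ripC y x); ring.
exact: rip_ge0.
Qed.

Lemma dot_rip x : ip x x = (rip x x)%:C.
Proof. by rewrite /rip RRe_real// ger0_real// dnorm_ge0. Qed.

End real_part.

Lemma gt0_realC (K : realType) (z : K[i]) :
  0 < z -> exists2 e : K, 0 < e & z = e%:C.
Proof.
case: z => a b; rewrite ltcE/= => /andP[/eqP b0 a0].
by exists a => //; rewrite b0.
Qed.

Lemma normr_lt_rip (K : realType) (V : normedModType K[i])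
    (ip : {dot V for Num.conj}) (hV : forall x : V, `|x| ^+ 2 = ip x x)
    (x : V) (e : K) :
  0 < e -> (`|x| < e%:C) = (rip ip x x < e ^+ 2).
Proof.
move=> e0; rewrite -(@ltr_pXn2r _ 2) ?nnegrE ?normr_ge0 ?ler0c ?ltW//.
by rewrite hV dot_rip -rmorphXn/= ltcR.
Qed.

(** * Minimization of a coercive quadratic functional *)

Section variational.
Variables (K : realType) (V : completeNormedModType K[i]).
Variables (ip : {dot V for Num.conj}) (hV : induces_norm ip).
Variables (T : V -> V) (c : K) (c_gt0 : 0 < c).
Hypothesis T_sym : forall x y, rip ip (T x) y = rip ip x (T y).
Hypothesis T_coercive : forall x, c * rip ip x x <= rip ip (T x) x.
Variables (L : V -> K) (C : K) (C_ge0 : 0 <= C).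
Hypothesis LD : {morph L : x y / x + y}.
Hypothesis LZ : forall (t : K) x, L (t%:C *: x) = t * L x.
Hypothesis L_bounded : forall x, L x ^+ 2 <= C * rip ip x x.

(** The energy whose Euler equation at a minimizer [u] is [L v = rip ip (T v) u]. *)
Let J x := rip ip (T x) x - 2 * L x.

Let J_lbound x : - C / c <= J x.
Proof.
rewrite ler_pdivrMr// /J.
have rx := rip_ge0 ip x; have Tx := T_coercive x; have Lx := L_bounded x.
set r := rip ip x x in rx Tx Lx; set l := L x in Lx *.
(* From [l ^+ 2 <= C * r] and the inequality of arithmetic and geometric means for [c ^+ 2 * r] and
   [C]. *)
have h : 2 * c * l <= c ^+ 2 * r + C.
  rewrite leNgt; apply/negP => lt_l.
  have s0 : 0 <= c ^+ 2 * r + C by rewrite addr_ge0// mulr_ge0// sqr_ge0.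
  have : (c ^+ 2 * r + C) ^+ 2 < (2 * c * l) ^+ 2.
    by rewrite ltr_pXn2r ?nnegrE// (le_trans _ (ltW lt_l)).
  have : 0 <= (c ^+ 2 * r - C) ^+ 2 by exact: sqr_ge0.
  have : c ^+ 2 * l ^+ 2 <= c ^+ 2 * (C * r) by rewrite ler_wpM2l// sqr_ge0.
  nra.
have : c * (c * r) <= c * rip ip (T x) x by rewrite ler_wpM2l// ltW.
by move: h; set q := rip ip (T x) x; rewrite expr2; lra.
Qed.

Let m := inf (range J).

Let m_le x : m <= J x.
Proof.
by apply: ge_inf; [exists (- C / c) => _ [y _ <-]; exact: J_lbound|exists x].
Qed.

Let near_min (e : K) : 0 < e -> exists x, J x < m + e.
Proof.
move=> e0.
have [|_ [x _ <-] h] := @inf_adherent K (range J) e e0; last by exists x.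
by split; [exists (J 0), 0|exists (- C / c) => _ [y _ <-]; exact: J_lbound].
Qed.

(* The derivative of [J] at an [e]-minimizer is small in the energy norm, which
   makes minimizing sequences Cauchy; [T] itself need not be continuous. *)
Let near_min_grad (e : K) x v : J x < m + e ->
  (rip ip (T v) x - L v) ^+ 2 <= e * rip ip (T v) v.
Proof.
move=> Jx; apply: quad_ge0_disc => [|t].
  by apply: le_trans (T_coercive v); rewrite mulr_ge0 ?rip_ge0// ltW.
(* [T] is not assumed linear: symmetry moves it to the other argument, so that only the scalar
   product is expanded. *)
have := m_le (x + t%:C *: v); rewrite /J LD LZ ripDr ripZr !T_sym !ripDl !ripZl.
have -> : rip ip x (T v) = rip ip v (T x) by rewrite -T_sym ripC.
by move: Jx; rewrite /J T_sym; nra.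
Qed.

(** In the direction [x - y] the energy [q] is the difference of the derivatives at [x] and [y],
    each with square at most [e * q]; hence [q ^+ 2 <= 4 * e * q]. *)
Let near_min_close (e : K) x y : J x < m + e -> J y < m + e ->
  c * rip ip (x - y) (x - y) <= 4 * e.
Proof.
move=> Jx Jy; have /= hx := near_min_grad (x - y) Jx.
have /= hy := near_min_grad (x - y) Jy.
apply: le_trans (T_coercive _) _.
set q := rip ip (T (x - y)) (x - y) in hx hy *.
have e0 : 0 < e by have := m_le x; lra.
have q0 : 0 <= q.
  by apply: le_trans (T_coercive _); rewrite mulr_ge0 ?rip_ge0// ltW.
have qE : q = (rip ip (T (x - y)) x - L (x - y))
    - (rip ip (T (x - y)) y - L (x - y)).
  by rewrite /q ripBr; ring.
move: qE hx hy; set a := _ - L _; set b := _ - L _ => qE hx hy.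
have h : q ^+ 2 <= 4 * e * q by have := sqr_ge0 (a + b); rewrite qE; nra.
rewrite leNgt; apply/negP => lt; nra.
Qed.

(** A minimizing sequence is Cauchy and its limit solves the Euler equation. As [T] acts on the test
    vector [v], the passage to the limit uses only Cauchy-Schwarz. *)
Lemma variational : exists u, forall v, L v = rip ip (T v) u.
Proof.
have /choice[u hu] : forall n : nat, exists x, J x < m + n.+1%:R^-1.
  by move=> n; apply: near_min; rewrite invr_gt0.
have u_cauchy : cauchy (u n @[n --> \oo]).
  apply: cauchy_exP => _/gt0_realC[e e0 ->].
  (* Chosen so that [near_min_close] turns an energy gap below it into a squared distance below
     [e ^+ 2]. *)
  have d0 : 0 < c * e ^+ 2 / 4 by rewrite divr_gt0// mulr_gt0// exprn_gt0.
  have [N _ hN] := near_infty_natSinv_lt (PosNum d0).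
  exists (u N), N => // n Nn; rewrite -ball_normE/= (normr_lt_rip hV)//.
  have J_lt k : (N <= k)%N -> J (u k) < m + N.+1%:R^-1.
    move=> Nk; apply: lt_le_trans (hu k) _.
    by rewrite lerD2l lef_pV2 ?posrE// ler_nat.
  have := near_min_close (J_lt N (leqnn N)) (J_lt n Nn).
  have /= := hN N (leqnn N); rewrite ltr_pdivlMr// => h1 h2.
  by rewrite -(ltr_pM2l c_gt0); apply: le_lt_trans h2 _; rewrite mulrC.
have /cvg_ex[w uw] : cvg (u n @[n --> \oo]) by exact: cauchy_cvg.
exists w => v; apply/eqP; rewrite eq_sym -subr_eq0 -sqrf_eq0; apply/eqP/le_anti.
rewrite sqr_ge0 andbT.
set q := rip ip (T v) v; set p := rip ip (T v) (T v).
have q0 : 0 <= q.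
  by apply: le_trans (T_coercive _); rewrite mulr_ge0 ?rip_ge0// ltW.
have p0 : 0 <= p by exact: rip_ge0.
(* Split at some [u n]: Cauchy-Schwarz bounds the square of one part by [e * p], [near_min_grad]
   that of the other by [e * q]. *)
suff h : forall e : K, 0 < e ->
    (rip ip (T v) w - L v) ^+ 2 <= e * (2 * q + 2 * p).
  rewrite leNgt; apply/negP; set d := _ ^+ 2 in h * => d0.
  have s0 : 0 < 2 * (2 * q + 2 * p + 1) by lra.
  have := h _ (divr_gt0 d0 s0).
  rewrite mulrAC ler_pdivlMr//; nra.
move=> e e0.
have [n [en nw]] : exists n : nat,
    n.+1%:R^-1 < e /\ rip ip (w - u n) (w - u n) < e.
  have rt0 : 0 < Num.sqrt e by rewrite sqrtr_gt0.
  have rtC0 : 0 < (Num.sqrt e)%:C by rewrite ltcR.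
  move/cvgrPdist_lt : uw => /(_ _ rtC0) uw.
  have [N _ hN] := filterI (near_infty_natSinv_lt (PosNum e0)) uw.
  have [/= h1] := hN N (leqnn N).
  by rewrite (normr_lt_rip hV)// sqr_sqrtr ?ltW// => h2; exists N.
have := near_min_grad v (hu n); have := rip_CS ip (T v) (w - u n).
rewrite ripBr -/q -/p.
set a := rip _ _ w; set b := rip _ _ (u n); set s := rip _ (_ - _) _ in nw *.
set t := _^-1 in en * => h1 h2.
have -> : a - L v = (a - b) + (b - L v) by ring.
have := sqr_ge0 ((a - b) - (b - L v)).
have : p * s <= p * e by rewrite ler_wpM2l// ltW.
have : t * q <= e * q by rewrite ler_wpM2r// ltW.
nra.
Qed.

End variational.

(* The Riesz representation theorem is the case [T = id], and the surjectivity
   of [T] is the case [l = ip ^~ b]. *)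
Lemma sym_coercive_riesz (K : realType) (V : completeNormedModType K[i])
    (ip : {dot V for Num.conj}) (T : V -> V) (c C : K) (l : V -> K[i]) :
  induces_norm ip -> 0 < c -> self_adjoint ip T ->
  (forall x, c * rip ip x x <= rip ip (T x) x) ->
  {morph l : x y / x + y} -> (forall a x, l (a *: x) = a * l x) ->
  0 <= C -> (forall x, complex.Re (l x) ^+ 2 <= C * rip ip x x) ->
  exists u, forall v, l v = ip v (T u).
Proof.
move=> hV c0 Tsym Tco lD lZ C0 lb.
have ReCM (t : K) z : complex.Re (t%:C * z) = t * complex.Re z.
  by case: z => a b /=; rewrite mul0r subr0.
have [||||u hu] := variational hV c0 _ Tco (L := fun x => complex.Re (l x)) C0.
- by move=> x y; rewrite /rip Tsym.
- by move=> x y; rewrite lD raddfD.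
- by move=> t x; rewrite lZ ReCM.
- exact: lb.
(* Only real parts are known to agree; [a = 1] and [a = 'i] give the real and the imaginary part. *)
exists u => v; have E a : complex.Re (l (a *: v)) = rip ip (a *: v) (T u).
  by rewrite hu /rip Tsym.
have := E 'i; have := E 1; rewrite !lZ /rip !linearZl_LR /=.
case: (l v) => a b; case: (ip v (T u)) => a' b' /=.
by rewrite !mul0r !mul1r !subr0 !sub0r => -> /oppr_inj ->.
Qed.

(** * Inverses and bijectivity of symmetric coercive operators *)

Section operator_inverse.
Variables (K : realType) (X Y : lmodType K[i]) (T : X -> Y).

Lemma opinvK : injective T -> cancel T (opinv T).
Proof.
by move=> Tinj x; apply: pinvKV; rewrite ?inE// => ? ? _ _; exact: Tinj.
Qed.

Lemma opinvKV : (forall y, exists x, T x = y) -> cancel (opinv T) T.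
Proof.
by move=> Tsurj y; apply: pinvK; have [x <-] := Tsurj y; rewrite inE; exists x.
Qed.

End operator_inverse.

Section nondegenerate.
Variables (K : realType) (V : lmodType K[i]) (ip : {dot V for Num.conj}).

Lemma rip_eq0 x : rip ip x x = 0 -> x = 0.
Proof. by move=> h; apply/eqP; rewrite -(dnorm_eq0 ip) dot_rip h. Qed.

Lemma dot_injr y z : (forall x, ip x y = ip x z) -> y = z.
Proof.
by move=> h; apply/subr0_eq/rip_eq0; rewrite ripBr /rip h subrr.
Qed.

End nondegenerate.

(** Symmetry replaces linearity of [T]: it turns the energy of [x - y] into the difference of the
    pairings of [T x] and [T y] with [x - y]. *)
Lemma coercive_inj (K : realType) (V : lmodType K[i])
    (ip : {dot V for Num.conj}) (T : V -> V) (c : K) :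
  0 < c -> self_adjoint ip T ->
  (forall x, c * rip ip x x <= rip ip (T x) x) -> injective T.
Proof.
move=> c0 Tsym Tco x y Txy; apply/subr0_eq/(rip_eq0 (ip := ip))/le_anti.
rewrite rip_ge0 andbT -(ler_pM2l c0) mulr0; apply: le_trans (Tco _) _.
by rewrite /rip Tsym -/(rip ip _ _) ripBl /rip -!Tsym Txy subrr.
Qed.

Lemma coercive_surj (K : realType) (V : completeNormedModType K[i])
    (ip : {dot V for Num.conj}) (T : V -> V) (c : K) :
  induces_norm ip -> 0 < c -> self_adjoint ip T ->
  (forall x, c * rip ip x x <= rip ip (T x) x) ->
  forall b, exists u, T u = b.
Proof.
move=> hV c0 Tsym Tco b.
have [||||u hu] := sym_coercive_riesz (C := rip ip b b) (l := ip ^~ b)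
  hV c0 Tsym Tco.
- by move=> x y; rewrite linearDl.
- by move=> a x; rewrite linearZl_LR.
- exact: rip_ge0.
- by move=> x; rewrite mulrC; exact: rip_CS.
by exists u; apply: (dot_injr (ip := ip)) => v; rewrite hu.
Qed.

(** * Boundedness and adjoints of compact operators *)

Lemma compact_set_bounded (K : numFieldType) (V : normedModType K) (A : set V) :
  compact A -> bounded_set A.
Proof.
move=> /compact_near_coveringP/(_ _ (+oo : set_system K)
  (fun M x => `|x| <= M)) h.
(* Near [x] the bound [|x| + 1] holds; compactness makes such local bounds uniform. *)
apply: h => x _; near=> y M => /=.
have -> : y = x + (y - x) by rewrite addrC subrK.
apply: le_trans (ler_normD _ _) _.
apply: (@le_trans _ _ (`|x| + 1)).
  rewrite lerD2l distrC; near: y; apply/nbhs_ballP; exists 1 => //= y.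
  by rewrite -ball_normE/= => /ltW.
by near: M; apply: nbhs_pinfty_ge; rewrite realD.
Unshelve. all: by end_near. Qed.

Lemma compact_op_bounded (K : realType) (X Y : normedModType K[i])
    (T : X -> Y) :
  compact_op T -> bounded_op T.
Proof.
move=> Tc.
have /Tc[U TU [/compact_set_bounded Ub _]] : bounded_set (ball (0 : X) 1).
  exists 1; split=> // r r1 x; rewrite -ball_normE/= sub0r normrN => /ltW x1.
  exact: le_trans x1 (ltW r1).
rewrite /bounded_op /bounded_near; near=> M.
apply/nbhs_ballP; exists 1 => //= x x1.
suff : U `<=` [set y | `|y| <= M] by apply; apply: TU; exists x.
by near: M.
Unshelve. all: by end_near. Qed.

Lemma compact_op_rip_le (K : realType) (X Y : normedModType K[i])
    (ipX : {dot X for Num.conj}) (ipY : {dot Y for Num.conj})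
    (T : {linear X -> Y}) :
  (forall x : X, `|x| ^+ 2 = ipX x x) -> (forall y : Y, `|y| ^+ 2 = ipY y y) ->
  compact_op T ->
  exists2 C, 0 <= C & forall x, rip ipY (T x) (T x) <= C * rip ipX x x.
Proof.
move=> hX hY /compact_op_bounded/linear_boundedP[M [Mreal TM]].
(* [M] is a real element of [K[i]]; a strictly larger bound coming from [K] is taken. *)
have [r rM] : exists r : K, M < r%:C.
  by exists (complex.Re M + 1); rewrite rmorphD/= RRe_real// ltrDl ltr01.
exists (r ^+ 2) => [|x]; first exact: sqr_ge0.
have : `|T x| ^+ 2 <= (r%:C * `|x|) ^+ 2.
  by rewrite ler_pXn2r ?nnegrE// ?TM// (le_trans _ (TM _ rM x)).
by rewrite exprMn hX hY !dot_rip -rmorphXn -rmorphM lecR.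
Qed.

(** Evaluates the choice in [adjoint]: by nondegeneracy of [ipX] at most one vector qualifies. *)
Lemma adjoint_uniq (K : realType) (X Y : lmodType K[i])
    (ipX : {dot X for Num.conj}) (ipY : Y -> Y -> K[i]) (T : X -> Y) y z :
  (forall x, ipY (T x) y = ipX x z) -> adjoint ipX ipY T y = z.
Proof.
move=> hz; apply: xget_unique => // z' hz'.
by apply: (dot_injr (ip := ipX)) => x; rewrite -hz hz'.
Qed.

(** Riesz representation of [x |-> ipY (T x) y], which is bounded because [T] is. *)
Lemma compact_adjointP (K : realType) (X Y : completeNormedModType K[i])
    (ipX : {dot X for Num.conj}) (ipY : {dot Y for Num.conj})
    (T : {linear X -> Y}) :
  induces_norm ipX -> induces_norm ipY -> compact_op T ->
  forall x y, ipY (T x) y = ipX x (adjoint ipX ipY T y).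
Proof.
move=> hX hY /(compact_op_rip_le hX hY)[C C0 hC] x y.
have [|||||z hz] := @sym_coercive_riesz _ _ ipX id 1 (C * rip ipY y y)
  (fun x => ipY (T x) y) hX ltr01 (fun _ _ => erefl).
- by move=> v; rewrite mul1r.
- by move=> v w; rewrite linearD linearDl.
- by move=> a v; rewrite linearZ linearZl_LR.
- by rewrite mulr_ge0// rip_ge0.
- move=> v; apply: le_trans (rip_CS ipY (T v) y) _.
  by rewrite mulrAC ler_wpM2r// rip_ge0.
by rewrite hz (adjoint_uniq hz).
Qed.

(* The information form of one Kalman step: [M] and [M'] are the inverses of the
   covariances before and after the step. *)
Section Woodbury.
Variables (X Y : zmodType) (R Rinv : Y -> Y) (A : X -> Y) (AH : Y -> X).
Variables (M M' B P : X -> X).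
Hypotheses (RK : cancel R Rinv) (RinvK : cancel Rinv R).
Hypotheses (MK : cancel M B) (BK : cancel B M).
Hypotheses (M'K : cancel M' P) (PK : cancel P M').
Hypotheses (Rinv_B : zmod_morphism Rinv) (AH_B : zmod_morphism AH).
Hypothesis M'_B : zmod_morphism M'.
Hypothesis M'E : forall x, M' x = M x + AH (Rinv (A x)).

Let S := R \+ (A \o B \o AH).

(** Under [M'] both sides become [AH y + AH (Rinv (A (B (AH y))))]. *)
Let push_through y : B (AH y) = P (AH (Rinv (S y))).
Proof.
apply: (can_inj M'K); rewrite PK M'E BK.
have -> : A (B (AH y)) = S y - R y by rewrite /S/= addrC addKr.
by rewrite Rinv_B RK AH_B addrC subrK.
Qed.

(** Woodbury's formula gives the preimage: [M' z = AH (Rinv y)] means [M z = AH (Rinv (y - A z))].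
    Surjectivity makes [opinv S] a right inverse, as the gain formula requires. *)
Lemma innovation_cov_surj y : exists w, S w = y.
Proof.
pose z := P (AH (Rinv y)); exists (Rinv (y - A z)).
have zE : B (AH (Rinv (y - A z))) = z.
  by rewrite Rinv_B AH_B -[AH (Rinv y)]PK -/z M'E addrK MK.
by rewrite /S/= RinvK zE subrK.
Qed.

Lemma kalman_gain_info Sinv : cancel Sinv S ->
  forall y, B (AH (Sinv y)) = P (AH (Rinv y)).
Proof. by move=> SinvK y; rewrite push_through SinvK. Qed.

Lemma kalman_cov_info x : B x - P (AH (Rinv (A (B x)))) = P x.
Proof. by apply: (can_inj M'K); rewrite M'_B !PK M'E BK addrK. Qed.

End Woodbury.

(** * Information form of the filter and the Tikhonov normal equation *)

Section kalman_tikhonov.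
Variables (K : realType) (X Y : completeNormedModType K[i]).
Variables (ipX : {dot X for Num.conj}) (ipY : {dot Y for Num.conj}).
Hypothesis hX : induces_norm ipX.
Variables (N : nat) (alpha : K) (alpha_gt0 : 0 < alpha).
Variables (R : {linear Y -> Y}) (R_selfadj : self_adjoint ipY R).
Hypotheses (R_posdef : positive_definite ipY R) (R_bij : bijective R).
Variables (f : nat -> Y) (A : nat -> {linear X -> Y}) (phi0 : X).
Let AH n := adjoint ipX ipY (A n).
Let Rinv := opinv R.
Hypothesis AHP : forall n, (n < N)%N ->
  forall x y, ipY (A n.+1 x) y = ipX x (AH n.+1 y).

Let RK : cancel R Rinv.
Proof. exact/opinvK/bij_inj. Qed.

Let RinvK : cancel Rinv R.
Proof. by apply: opinvKV => y; case: R_bij => g _ gK; exists (g y). Qed.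

Let Rinv_B : zmod_morphism Rinv.
Proof. by move=> x y; apply: (can_inj RK); rewrite linearB/= !RinvK. Qed.

Let Rinv_selfadj : self_adjoint ipY Rinv.
Proof. by move=> x y; rewrite -{1}(RinvK y) -R_selfadj RinvK. Qed.

Let Rinv_ge0 w : 0 <= rip ipY (Rinv w) w.
Proof.
have [->|w0] := eqVneq (Rinv w) 0; first by rewrite rip0l.
have : 0 < ipY w (Rinv w) by rewrite -{1}(RinvK w); exact: R_posdef.
by rewrite ripC ltcE => /andP[_ /ltW].
Qed.

Let AHP' n x y : (n < N)%N -> ipX (AH n.+1 y) x = ipY y (A n.+1 x).
Proof. by move=> nN; rewrite [LHS]dotC -AHP// [RHS]dotC. Qed.

Let AH_B n : (n < N)%N -> zmod_morphism (AH n.+1).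
Proof.
by move=> nN y z; apply: adjoint_uniq => x; rewrite !dotBr !AHP.
Qed.

(** The operator [M_n], inverse to the covariance [B_n]; [M_N] is the operator inverted by the full
    Tikhonov solution. *)
Let info n x : X := alpha%:C *: x + \sum_(k < n) AH k.+1 (Rinv (A k.+1 x)).

Let infoS n x : info n.+1 x = info n x + AH n.+1 (Rinv (A n.+1 x)).
Proof. by rewrite /info big_ord_recr/= addrA. Qed.

Let info_B n : (n <= N)%N -> zmod_morphism (info n).
Proof.
move=> nN x y; rewrite /info scalerBr opprD addrACA -sumrB; congr (_ + _).
apply: eq_bigr => k _; rewrite linearB/= Rinv_B AH_B//.
exact: leq_trans (ltn_ord k) nN.
Qed.

Let info_D n x y : (n <= N)%N -> info n (x + y) = info n x + info n y.
Proof. by move=> nN; apply/eqP; rewrite -subr_eq -info_B// addrK. Qed.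

Let info_selfadj n : (n <= N)%N -> self_adjoint ipX (info n).
Proof.
move=> nN x y; rewrite /info linearDl linearDr/= dot_realZ.
congr (_ + _); rewrite dot_suml dot_sumr; apply: eq_bigr => k _.
have kN := leq_trans (ltn_ord k) nN.
by rewrite AHP'// -AHP// Rinv_selfadj.
Qed.

Let info_coercive n : (n <= N)%N ->
  forall x, alpha * rip ipX x x <= rip ipX (info n x) x.
Proof.
move=> nN x; rewrite /info ripDl ripZl lerDl /rip dot_suml raddf_sum.
apply: sumr_ge0 => k _; rewrite AHP' ?Rinv_ge0//.
exact: leq_trans (ltn_ord k) nN.
Qed.

Let infoK n : (n <= N)%N -> cancel (info n) (opinv (info n)).
Proof.
move=> nN; apply/opinvK.
exact: (coercive_inj alpha_gt0 (info_selfadj nN) (info_coercive nN)).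
Qed.

Let infoKV n : (n <= N)%N -> cancel (opinv (info n)) (info n).
Proof.
move=> nN; apply/opinvKV.
exact: (coercive_surj hX alpha_gt0 (info_selfadj nN) (info_coercive nN)).
Qed.

Let kalman_info n : (n <= N)%N ->
  let: (phi, B) := kalman ipX ipY alpha R A f phi0 n in
  B =1 opinv (info n) /\
  info n (phi - phi0) =
    \sum_(k < n) AH k.+1 (Rinv (f k.+1 - A k.+1 phi0)).
Proof.
elim: n => [|n IHn] nN /=.
  split=> [x|]; last first.
    by rewrite /info !big_ord0 subrr scaler0 addr0.
  apply: (can_inj (infoK nN)); rewrite infoKV// /info big_ord0 addr0.
  by rewrite scalerA divff ?scale1r// gt_eqF// ltcR.
case: kalman (IHn (ltnW nN)) => phi B [BE phiE].
have MK : cancel (info n) B by move=> x; rewrite BE infoK// ltnW.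
have BK : cancel B (info n) by move=> x; rewrite BE infoKV// ltnW.
have gainE y : kalman_gain ipX ipY R A n.+1 B y
    = opinv (info n.+1) (AH n.+1 (Rinv y)).
  apply: (kalman_gain_info RK BK (infoK nN) (infoKV nN) Rinv_B (AH_B nN)
    (infoS n)).
  apply: opinvKV.
  exact: (innovation_cov_surj RinvK MK (infoKV nN) Rinv_B (AH_B nN) (infoS n)).
split=> [x|].
  rewrite /= gainE.
  exact: (kalman_cov_info BK (infoK nN) (infoKV nN) (info_B nN) (infoS n)).
(* The term by which [info n.+1] exceeds [info n], applied to [phi - phi0], trades the residual at
   [phi] for the one at [phi0]. *)
rewrite addrAC gainE info_D// infoKV// infoS phiE big_ord_recr/= -addrA.
congr (_ + _); apply/eqP; rewrite eq_sym -subr_eq -AH_B// -Rinv_B.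
by rewrite (linearB (A n.+1)) opprB addrC addrA subrK.
Qed.

Lemma kalman_eq_tikhonov :
  kalman_state ipX ipY alpha R A f phi0 N
  = full_tikhonov ipX ipY alpha R A f phi0 N.
Proof.
(* Exhibiting the sum also shows that the stacked operator has an adjoint. *)
have vAHE g : adjoint ipX (prod_ip (N := N) ipY) (stack_op N A) g =
    \sum_(i < N) AH i.+1 (g i).
  apply: adjoint_uniq => x; rewrite dot_sumr; apply: eq_bigr => i _.
  by rewrite !ffunE AHP.
rewrite /kalman_state /full_tikhonov.
have := kalman_info (leqnn N); case: kalman => phi B [_ phiE] /=.
rewrite -[phi in LHS](subrK phi0) addrC vAHE; congr (_ + _).
set T := (fun x => _); have -> : T = info N.
  apply/funext => x; rewrite /T vAHE; congr (_ + _).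
  by apply: eq_bigr => i _; rewrite !ffunE.
(* Both corrections to [phi0] solve the same normal equation, and [info N] is injective. *)
apply: (can_inj (infoK (leqnn N))); rewrite infoKV// phiE.
by apply: eq_bigr => i _; rewrite !ffunE.
Qed.

End kalman_tikhonov.

Theorem theorem4p3 (K : realType) (X Y : completeNormedModType K[i])
    (ipX : {dot X for Num.conj}) (ipY : {dot Y for Num.conj})
    (hX : induces_norm ipX) (hY : induces_norm ipY)
    (N : nat) (alpha : K) (alpha_gt0 : 0 < alpha)
    (R : {linear Y -> Y}) (R_bounded : bounded_op R)
    (R_selfadj : self_adjoint ipY R) (R_posdef : positive_definite ipY R)
    (R_bij : bijective R) (Rinv_bounded : bounded_op (opinv R))
    (f : nat -> Y) (A : nat -> {linear X -> Y})
    (A_compact : forall n, (1 <= n <= N)%N -> compact_op (A n))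
    (phi0 : X) :
  kalman_state ipX ipY alpha R A f phi0 N
  = full_tikhonov ipX ipY alpha R A f phi0 N.
Proof.
apply: kalman_eq_tikhonov => // n nN.
(* By computation, [n < N] is the range condition [1 <= n.+1 <= N]. *)
exact: (compact_adjointP hX hY (A_compact n.+1 nN)).
Qed.
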